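(* Let $\epsilon \ge 0$ and let $X$ be a non-degenerate real-valued random variable with $E[X]=0$ and $E[X^2]<\infty$. For any $Y \in \mathcal{V}_{\epsilon}(X)$ such that $\mathrm{var}\, E[X\mid X+Y]$ attains the minimum $L(X,\epsilon)$, i.e. $\mathrm{var}\, E[X\mid X+Y]=L(X,\epsilon)$, we must have $E[Y^2]=\epsilon^2$.
   Context: For a real-valued square-integrable random variable $X$ with mean $0$ and a real number $\epsilon \ge 0$, define $$\mathcal{V}_{\epsilon}(X) := \{ Y : Y \text{ is a real-valued random variable independent of } X,\ E[Y]=0 \text{ and } E[Y^2]\le \epsilon^2\},$$ $$L(X,\epsilon) := \inf_{Y\in \mathcal{V}_{\epsilon}(X)} \mathrm{var}\, E[X\mid X+Y].$$ Here $E[X\mid X+Y]$ is the conditional expectation of $X$ given $\sigma(X+Y)$. Non-degenerate means not almost surely constant. Convention: the underlying probability space is allowed to be enlarged, so that random variables with any prescribed law independent of the given ones are available. Since $\mathrm{var}\,E[X\mid X+Y]$ depends only on the joint law of $(X,Y)$, membership in $\mathcal{V}_\epsilon(X)$ and the infimum may equivalently be understood as ranging over all probability laws of $Y$ on $\mathbb{R}$ with mean $0$ and second moment at most $\epsilon^2$, with $(X,Y)$ having the product law. *)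

(* Defs.v *)
From HB Require Import structures.
From mathcomp Require Import all_boot all_order all_algebra.
From mathcomp Require Import all_classical all_reals all_analysis.

Set Implicit Arguments.
Unset Strict Implicit.
Unset Printing Implicit Defensive.

Import Order.TTheory GRing.Theory Num.Theory.
Import numFieldNormedType.Exports.

Local Open Scope classical_set_scope.
Local Open Scope ring_scope.
Local Open Scope ereal_scope.

Definition independent_rv (d : measure_display) (T : measurableType d)
    (R : realType) (P : probability T R) (X Y : T -> R) : Prop :=
  forall A B : set R, measurable A -> measurable B ->
    P (X @^-1` A `&` Y @^-1` B) = P (X @^-1` A) * P (Y @^-1` B).

Definition nondegenerate_rv (d : measure_display) (T : measurableType d)
    (R : realType) (P : probability T R) (X : T -> R) : Prop :=
  ~ exists c : R, {ae P, forall x, X x = c}.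

(* [Z] is a version of the conditional expectation E[X | W], that is, of X
   given sigma(W).  Such a version exists as soon as X is integrable, and any
   two versions agree almost surely, so that 'V_P[Z] depends only on X and W. *)
Definition is_condexp (d : measure_display) (T : measurableType d)
    (R : realType) (P : probability T R) (X W Z : T -> R) : Prop :=
  let sigmaW := g_sigma_algebra_preimage W in
  [/\ P.-integrable setT (EFin \o Z),
      forall B : set R, measurable B -> sigmaW (Z @^-1` B) &
      forall A : set T, sigmaW A ->
        \int[P]_(x in A) (Z x)%:E = \int[P]_(x in A) (X x)%:E].

(* The class V_eps(X), among the random variables on the given space. *)
Definition calV (d : measure_display) (T : measurableType d) (R : realType)
    (P : probability T R) (X : T -> R) (eps : R) : set {RV P >-> R} :=
  [set Y : {RV P >-> R} | [/\ independent_rv P X Y, 'E_P[Y] = 0 &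
    'E_P[fun x => (Y x ^+ 2)%R] <= (eps ^+ 2)%:E]].
Arguments calV {d T R} P X eps.

(* L(X, eps).  The infimum is over the random variables Y on all the
   enlargements (T * R, P \x nu) of the space carrying X, where X is identified
   with [X \o fst].  Since nu is arbitrary, every law of Y with mean 0 and
   second moment at most eps ^+ 2 occurs (take for nu that law and Y := snd). *)
Definition minvar (d : measure_display) (T : measurableType d) (R : realType)
    (P : probability T R) (X : T -> R) (eps : R) : \bar R :=
  ereal_inf [set v | exists (nu : probability R R)
      (Y : {RV (P \x nu) >-> R}) (Z : T * R -> R),
    [/\ calV (P \x nu) (X \o fst) eps Y,
        is_condexp (P \x nu) (X \o fst) ((X \o fst) \+ Y)%R Z &
        v = 'V_(P \x nu)[Z]]].

(* Main.v *)
Require Import Defs.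
From HB Require Import structures.
From mathcomp Require Import all_boot all_order all_algebra.
From mathcomp Require Import all_classical all_reals all_analysis.
From mathcomp Require Import measurable_realfun ring lra.

Set Implicit Arguments.
Unset Strict Implicit.
Unset Printing Implicit Defensive.

Import Order.TTheory GRing.Theory Num.Theory.
Import numFieldNormedType.Exports.

Local Open Scope classical_set_scope.
Local Open Scope ring_scope.
Local Open Scope ereal_scope.

(** The inequality [E[Y^2] <= eps^2] cannot be strict at a minimizer because the
    remaining second moment could be spent on more noise, and more noise strictly
    lowers the variance of the conditional expectation.

    Write [S = X + Y] and [Z = E[X | S]], and suppose [E[Y^2] < eps^2]. On the
    product of the given space with the real line let [W] be a centred Gaussian
    noise of variance at most [eps^2 - E[Y^2]], independent of [(X, Y)]. Then
    [Y + W] still satisfies the constraints ([independent_noisy], [noisy_mean],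
    [noisy_second_moment]). Let [Z' = h(S + W)] be the conditional expectation of
    [X] given [S + W] ([condexp_exists]). It is also the conditional expectation of
    [Z] given [S + W] ([condexp_noisy]), so by Pythagoras ([condexp_pythagoras])
    [E[Z^2] = E[(Z - Z')^2] + E[Z'^2]]. Both conditional expectations have mean 0,
    so these second moments are variances, and minimality of [Y] forces [Z' = Z]
    almost surely.

    The value of [Z] is thus unaffected by a noise that spreads [S] over the whole
    line, so [Z] is almost surely constant ([diffuse_noise_ae_constant]) and hence
    equal to its mean 0. But then [E[X^2] = E[X * (X + Y)] = E[Z * (X + Y)] = 0]
    ([condexp_sum_eq0]), so that [X] is degenerate.

    The square-integrability of [Z] that these computations need comes from
    [condexp_sqr_integrable], and the passage from integrals over events to
    integrals of products from [integral_mul_eq0]. *)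

(** * Integrating against functions of a random variable *)

Section integral_against_function_of.
Context (d : measure_display) (T : measurableType d) (R : realType)
  (mu : {measure set T -> \bar R}).
Implicit Types f V : T -> R.

Import HBNNSimple.

Lemma integral_mul_simple_eq0 f V (p : {nnsfun R >-> R}) :
  mu.-integrable setT (EFin \o f) -> measurable_fun setT V ->
  (forall B : set R, measurable B -> \int[mu]_(x in V @^-1` B) (f x)%:E = 0) ->
  \int[mu]_x (f x * p (V x))%:E = 0.
Proof.
move=> intf mV f0.
have mVB B : measurable B -> measurable (V @^-1` B).
  by move=> mB; rewrite -[X in measurable X]setTI; exact: mV.
pose g (r : R) x := r%:E * ((EFin \o f) \_ (V @^-1` (p @^-1` [set r]))) x.
have E x : (f x * p (V x))%:E =
    \sum_(r <- finmap.enum_fset (fset_set (range p))) g r x.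
  rewrite fimfunE fsbig_finite//= mulr_sumr -sumEFin.
  apply: eq_bigr => r _; rewrite /g patchE indicE.
  rewrite (_ : (x \in _) = (V x \in p @^-1` [set r])) //.
  case: ifPn => _ /=; first by rewrite mulr1 mulrC EFinM.
  by rewrite !mulr0 mule0.
have mg r : measurable (p @^-1` [set r]) by exact: measurable_sfunP.
have ig r : mu.-integrable setT
    ((EFin \o f) \_ (V @^-1` (p @^-1` [set r]))).
  apply/(integrable_mkcond (EFin \o f)); first exact: mVB.
  by apply: integrableS intf => //; exact: mVB.
under eq_integral do rewrite E.
rewrite integral_sum//; last by move=> r; exact: integrableZl.
by rewrite big1// => r _; rewrite integralZl// -integral_mkcond f0// mule0.
Qed.

(** Simple functions increase to [phi]; [|f * (phi \o V)|] dominates the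
    corresponding products, so the previous lemma passes to the limit. *)
Lemma integral_mul_ge0_eq0 f V (phi : R -> R) :
  mu.-integrable setT (EFin \o f) -> measurable_fun setT V ->
  (forall B : set R, measurable B -> \int[mu]_(x in V @^-1` B) (f x)%:E = 0) ->
  measurable_fun setT phi -> (forall r, 0 <= phi r)%R ->
  mu.-integrable setT (fun x => (f x * phi (V x))%:E) ->
  \int[mu]_x (f x * phi (V x))%:E = 0.
Proof.
move=> intf mV f0 mphi phi0 intfphi.
have mf : measurable_fun setT f.
  by apply/measurable_EFinP; exact: measurable_int intf.
have mEphi : measurable_fun setT (EFin \o phi) by exact/measurable_EFinP.
have Ephi0 x : setT x -> 0 <= (EFin \o phi) x by rewrite /= lee_fin.
pose p := nnsfun_approx measurableT mEphi.
have ple n r : (p n r <= phi r)%R.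
  by rewrite -lee_fin /p nnsfun_approxE; exact: le_approx.
have [| | | | |_ _] := @dominated_convergence _ _ _ mu setT measurableT
  (fun n x => (f x * p n (V x))%:E) (fun x => (f x * phi (V x))%:E)
  (fun x => `|(f x * phi (V x))%:E|).
- move=> n; apply/measurable_EFinP/measurable_funM => //.
  by apply: measurableT_comp.
- exact: measurable_int intfphi.
- apply: aeW => x _; under eq_fun do rewrite EFinM.
  rewrite EFinM; apply: cvgeZl => //.
  exact: (cvg_nnsfun_approx measurableT mEphi).
- exact: integrable_abse.
- apply: aeW => x n _ /=; rewrite lee_fin !normrM ler_wpM2l//.
  by rewrite !ger0_norm.
rewrite (_ : [sequence _]_n = cst 0); last first.
  by apply/funext => n /=; exact: integral_mul_simple_eq0.
by move/cvg_unique; apply => //; exact: cvg_cst.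
Qed.

(** The defining property of a conditional expectation only tests against
    events. Applied to the difference of a variable and its conditional
    expectation, or to the centred indicator of an event independent of [V],
    this lemma turns it into a test against [V] itself. *)
Lemma integral_mul_eq0 f V :
  mu.-integrable setT (EFin \o f) -> measurable_fun setT V ->
  (forall B : set R, measurable B -> \int[mu]_(x in V @^-1` B) (f x)%:E = 0) ->
  mu.-integrable setT (fun x => (f x * V x)%:E) ->
  \int[mu]_x (f x * V x)%:E = 0.
Proof.
move=> intf mV f0 intfV.
have mf : measurable_fun setT f.
  by apply/measurable_EFinP; exact: measurable_int intf.
pose pos (r : R) : R := Num.max r 0%R.
pose neg (r : R) : R := Num.max (- r)%R 0%R.
have mpos : measurable_fun setT pos by exact: measurable_maxr.
have mneg : measurable_fun setT neg.
  by apply: measurable_maxr => //; exact: oppr_measurable.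
have pos0 r : (0 <= pos r)%R by rewrite le_max lexx orbT.
have neg0 r : (0 <= neg r)%R by rewrite le_max lexx orbT.
have posneg r : r = (pos r - neg r)%R.
  by rewrite /pos /neg; case: (leP r 0%R); case: (leP (- r)%R 0%R); lra.
have posle r : (`|pos r| <= `|r|)%R.
  by rewrite ger0_norm// ge_max normr_ge0 ler_norm.
have negle r : (`|neg r| <= `|r|)%R.
  by rewrite ger0_norm// ge_max -(normrN r) ler_norm normr_ge0.
have int (phi : R -> R) : measurable_fun setT phi ->
    (forall r, `|phi r| <= `|r|)%R ->
    mu.-integrable setT (fun x => (f x * phi (V x))%:E).
  move=> mphi phile; apply: le_integrable intfV => //.
    by apply/measurable_EFinP/measurable_funM => //; exact: measurableT_comp.
  by move=> x _; rewrite /= lee_fin !normrM ler_wpM2l.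
under eq_integral do rewrite (posneg (V _)) mulrBr EFinB.
rewrite integralB; [|by []|exact: int|exact: int].
by rewrite !integral_mul_ge0_eq0 ?subee//; exact: int.
Qed.

End integral_against_function_of.

(** * Square-integrable functions *)

Section square_integrable.
Context (d : measure_display) (T : measurableType d) (R : realType)
  (mu : {measure set T -> \bar R}).
Implicit Types U V : T -> R.

Lemma integrable_mul_of_sqr U V :
  measurable_fun setT U -> measurable_fun setT V ->
  mu.-integrable setT (fun x => (U x ^+ 2)%:E) ->
  mu.-integrable setT (fun x => (V x ^+ 2)%:E) ->
  mu.-integrable setT (fun x => (U x * V x)%:E).
Proof.
move=> mU mV iU iV.
apply: le_integrable (integrableD measurableT iU iV) => //.
  by apply/measurable_EFinP; exact: measurable_funM.
move=> x _; rewrite /= lee_fin (ger0_norm (addr_ge0 (sqr_ge0 _) (sqr_ge0 _))).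
rewrite ler_norml.
have := sqr_ge0 (U x + V x); have := sqr_ge0 (U x - V x).
have := sqr_ge0 (U x); have := sqr_ge0 (V x); rewrite !expr2; lra.
Qed.

Lemma integrable_sqrB U V :
  measurable_fun setT U -> measurable_fun setT V ->
  mu.-integrable setT (fun x => (U x ^+ 2)%:E) ->
  mu.-integrable setT (fun x => (V x ^+ 2)%:E) ->
  mu.-integrable setT (fun x => ((U x - V x) ^+ 2)%:E).
Proof.
move=> mU mV iU iV; have iUV := integrable_mul_of_sqr mU mV iU iV.
have := integrableD measurableT (integrableB measurableT iU
  (integrableZl measurableT 2 iUV)) iV.
apply: eq_integrable => // x _ /=; congr EFin.
by rewrite !expr2; ring.
Qed.

(** The hypothesis on [U * V] says that [V] is orthogonal to [U - V]. *)
Lemma integral_pythagoras U V :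
  measurable_fun setT U -> measurable_fun setT V ->
  mu.-integrable setT (fun x => (U x ^+ 2)%:E) ->
  mu.-integrable setT (fun x => (V x ^+ 2)%:E) ->
  \int[mu]_x (U x * V x)%:E = \int[mu]_x (V x ^+ 2)%:E ->
  \int[mu]_x (U x ^+ 2)%:E =
    \int[mu]_x ((U x - V x) ^+ 2)%:E + \int[mu]_x (V x ^+ 2)%:E.
Proof.
move=> mU mV iU iV UVE; have iUV := integrable_mul_of_sqr mU mV iU iV.
have iB := integrable_sqrB mU mV iU iV.
have iC := integrableB measurableT iUV iV.
rewrite -integralD// -[RHS]adde0 -[X in _ = _ + X](mule0 2%:E).
rewrite -[X in _ = _ + _ * X](_ :
    \int[mu]_x ((U x * V x)%:E - (V x ^+ 2)%:E) = 0).
  rewrite -integralZl// -integralD//; last 2 first.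
  - exact: integrableD.
  - exact: integrableZl.
  apply: eq_integral => x _; rewrite /=; congr EFin.
  by rewrite !expr2; ring.
by rewrite integralB// UVE subee// integrable_fin_num.
Qed.

End square_integrable.

(** * Conditional expectation *)

Section conditional_expectation.
Context (d : measure_display) (T : measurableType d) (R : realType)
  (P : probability T R).
Implicit Types U V W Z : T -> R.

Lemma preimage_algebra_measurable W A :
  measurable_fun setT W -> g_sigma_algebra_preimage W A -> measurable A.
Proof. by move=> mW [B mB <-]; exact: mW. Qed.

Lemma preimage_algebra_measurable_fun W V :
  measurable_fun setT W ->
  (forall B, measurable B -> g_sigma_algebra_preimage W (V @^-1` B)) ->
  measurable_fun setT V.
Proof.
move=> mW hV _ B mB; rewrite setTI.
exact: preimage_algebra_measurable (hV _ mB).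
Qed.

Lemma condexp_integral_mul U W Z V :
  P.-integrable setT (EFin \o U) -> measurable_fun setT W ->
  is_condexp P U W Z ->
  (forall B, measurable B -> g_sigma_algebra_preimage W (V @^-1` B)) ->
  P.-integrable setT (fun x => (U x * V x)%:E) ->
  P.-integrable setT (fun x => (Z x * V x)%:E) ->
  \int[P]_x (U x * V x)%:E = \int[P]_x (Z x * V x)%:E.
Proof.
move=> iU mW [iZ _ ZU] hV iUV iZV.
have mV := preimage_algebra_measurable_fun mW hV.
have mVB B : measurable B -> measurable (V @^-1` B).
  by move=> mB; exact: preimage_algebra_measurable (hV _ mB).
rewrite -[LHS](@subeK _ _ (\int[P]_x (Z x * V x)%:E)) ?integrable_fin_num//.
rewrite -[RHS]add0e; congr (_ + _); rewrite -integralB//.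
under eq_integral do rewrite -EFinB -mulrBl.
apply: (@integral_mul_eq0 _ _ _ _ (U \- Z)%R V) => //.
- by have := integrableB measurableT iU iZ; apply: eq_integrable.
- move=> B mB; under eq_integral do rewrite EFinB.
  have mVB' := mVB _ mB.
  have iUB : P.-integrable (V @^-1` B) (EFin \o U) by exact: integrableS iU.
  have iZB : P.-integrable (V @^-1` B) (EFin \o Z) by exact: integrableS iZ.
  by rewrite integralB// ZU ?subee ?integrable_fin_num//; exact: hV.
- have := integrableB measurableT iUV iZV; apply: eq_integrable => // x _ /=.
  by rewrite -EFinB mulrBl.
Qed.

Lemma integrable_of_sqr U : measurable_fun setT U ->
  P.-integrable setT (fun x => (U x ^+ 2)%:E) ->
  P.-integrable setT (EFin \o U).
Proof.
move=> mU iU.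
have i1 : P.-integrable setT (fun=> (1 ^+ 2)%:E).
  by rewrite expr1n; exact: finite_measure_integrable_cst.
have m1 : measurable_fun setT (cst 1%R : T -> R) by exact: measurable_cst.
have := integrable_mul_of_sqr mU m1 iU i1.
by apply: eq_integrable => // x _ /=; rewrite mulr1.
Qed.

(** The product [U * Z] is not known to be integrable beforehand, so [Z] is
    truncated: testing against [V n], the truncation of [Z] at level [n], shows
    that [V n] is orthogonal to [U - V n], hence that its second moment is at
    most that of [U]; then [n] tends to infinity. *)
Lemma condexp_sqr_integrable U W Z :
  measurable_fun setT U -> measurable_fun setT W ->
  P.-integrable setT (fun x => (U x ^+ 2)%:E) ->
  is_condexp P U W Z -> P.-integrable setT (fun x => (Z x ^+ 2)%:E).
Proof.
move=> mU mW iU2 ce; have [iZ hZ _] := ce.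
have iU := integrable_of_sqr mU iU2.
have mZ := preimage_algebra_measurable_fun mW hZ.
pose trunc (n : nat) (r : R) : R := if (`|r| <= n%:R)%R then r else 0%R.
have mtrunc n : measurable_fun setT (trunc n).
  apply: measurable_fun_ifT => //; exact: measurable_fun_ler.
pose V n x := trunc n (Z x).
have mV n : measurable_fun setT (V n) by exact: measurableT_comp.
have Vle n x : (`|V n x| <= n%:R)%R.
  by rewrite /V /trunc; case: ifPn => // _; rewrite normr0.
have iV2 n : P.-integrable setT (fun x => (V n x ^+ 2)%:E).
  apply: (@measurable_bounded_integrable _ _ _ P (fun x => V n x ^+ 2)%R) => //.
  - by rewrite -ge0_fin_numE ?fin_num_measure.
  - exact: measurable_funX.
  - exists (n%:R ^+ 2)%R; split; rewrite ?num_real// => M Mn x _ /=.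
    rewrite normrX (le_trans _ (ltW Mn))// lerXn2r// ?nnegrE//.
have ZVE n x : (Z x * V n x = V n x ^+ 2)%R.
  by rewrite /V /trunc; case: ifPn => _; rewrite ?expr2// mulr0 mulr0.
have V2le n : \int[P]_x (V n x ^+ 2)%:E <= \int[P]_x (U x ^+ 2)%:E.
  rewrite (integral_pythagoras mU (mV n))//.
    by rewrite leeDr// integral_ge0// => x _; rewrite lee_fin sqr_ge0.
  rewrite (condexp_integral_mul iU mW ce).
  - by apply: eq_integral => x _; rewrite ZVE.
  - by move=> B mB; apply: (hZ (trunc n @^-1` B));
       rewrite -[X in measurable X]setTI; exact: mtrunc.
  - exact: integrable_mul_of_sqr.
  - by apply: eq_integrable (iV2 n) => // x _; rewrite ZVE.
apply/integrableP; split.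
  by apply/measurable_EFinP; exact: measurable_funX.
apply: (@le_lt_trans _ _ (\int[P]_x (U x ^+ 2)%:E)); last first.
  rewrite -ge0_fin_numE ?integrable_fin_num// integral_ge0// => x _.
  by rewrite lee_fin sqr_ge0.
have -> : \int[P]_x `|(Z x ^+ 2)%:E| =
    \int[P]_x limn (fun n => (V n x ^+ 2)%:E).
  apply: eq_integral => x _; rewrite gee0_abs ?lee_fin ?sqr_ge0//.
  apply/esym/cvg_lim => //; apply: cvg_near_cst; near=> n.
  rewrite /V /trunc ifT//; near: n; exact: nbhs_infty_ger.
have V2nd m n x : (m <= n)%N -> (V m x ^+ 2)%:E <= (V n x ^+ 2)%:E.
  move=> mn; rewrite lee_fin /V /trunc; case: ifPn => [Zm|_].
    by rewrite (le_trans Zm) ?ler_nat.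
  by rewrite expr0n sqr_ge0.
have mV2 n : measurable_fun setT (fun x => (V n x ^+ 2)%:E).
  by apply/measurable_EFinP; exact: measurable_funX.
have V20 n x : 0 <= (V n x ^+ 2)%:E by rewrite lee_fin sqr_ge0.
rewrite monotone_convergence//; last by move=> x _ m n; exact: V2nd.
apply: lime_le; last exact: nearW.
apply: ereal_nondecreasing_is_cvgn => m n mn.
by apply: ge0_le_integral => // x _; exact: V2nd.
Unshelve. all: by end_near. Qed.

End conditional_expectation.

Section conditional_expectation_theory.
Context (d : measure_display) (T : measurableType d) (R : realType)
  (P : probability T R).
Implicit Types U V W Z : T -> R.

Lemma condexp_pythagoras U W Z :
  measurable_fun setT U -> measurable_fun setT W ->
  P.-integrable setT (fun x => (U x ^+ 2)%:E) -> is_condexp P U W Z ->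
  \int[P]_x (U x ^+ 2)%:E =
    \int[P]_x ((U x - Z x) ^+ 2)%:E + \int[P]_x (Z x ^+ 2)%:E.
Proof.
move=> mU mW iU2 ce; have iZ2 := condexp_sqr_integrable mU mW iU2 ce.
have iU := integrable_of_sqr mU iU2.
have [_ hZ _] := ce; have mZ := preimage_algebra_measurable_fun mW hZ.
apply: integral_pythagoras => //.
rewrite (condexp_integral_mul iU mW ce hZ).
- by apply: eq_integral => x _; rewrite expr2.
- exact: integrable_mul_of_sqr.
- by apply: eq_integrable iZ2 => // x _; rewrite expr2.
Qed.

(** Radon-Nikodym on the real line: [g] is the density, with respect to the law
    of [W], of the image under [W] of the signed measure with density [U]. Working
    with the image measures produces a version that is a function of [W]. *)
Lemma condexp_exists U (W : {RV P >-> R}) :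
  P.-integrable setT (EFin \o U) ->
  exists2 h : R -> R, measurable_fun setT h & is_condexp P U W (h \o W).
Proof.
move=> iU; have mW : measurable_fun setT W by [].
have mWB B : measurable B -> measurable (W @^-1` B).
  by move=> mB; rewrite -[X in measurable X]setTI; exact: mW.
(* [nu_of] still abstracts over the measurability proof of [W] *)
pose nu_of : {charge set R -> \bar R} := pushforward (induced_charge iU) W.
pose nu := nu_of mW.
have numu : nu `<< distribution P W.
  apply/null_content_dominatesP => B mB PB0; apply: null_set_integral => //.
  - exact: mWB.
  - apply: (measurable_int P).
    exact: (integrableS measurableT (mWB _ mB) (@subsetT _ _) iU).
pose g := Radon_Nikodym nu (distribution P W).
have ig : (distribution P W).-integrable setT g.
  exact: Radon_Nikodym_integrable.
have gfin r : g r \is a fin_num by exact: Radon_Nikodym_fin_num.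
have mg := measurable_int _ ig.
have igW : P.-integrable setT (g \o W).
  apply/integrableP; split; first exact: measurableT_comp.
  have /integrableP[_] := ig; rewrite ge0_integral_distribution//.
  exact: measurableT_comp.
have gE x : ((fine \o g) (W x))%:E = g (W x) by rewrite /= fineK.
have mfg : measurable_fun setT (fine \o g) by exact: measurableT_comp.
exists (fine \o g) => //.
split.
- by apply: eq_integrable igW => // x _; rewrite /= fineK.
- move=> B mB; exists ((fine \o g) @^-1` B); last by rewrite setTI.
  by rewrite -[X in measurable X]setTI; exact: mfg.
- move=> _ [B mB <-]; rewrite setTI.
  transitivity (nu B) => //; rewrite (Radon_Nikodym_integral numu mB).
  rewrite /distribution integral_pushforward//.
    by apply: eq_integral => x _; rewrite gE.
  by apply: integrableS igW => //; exact: mWB.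
Qed.

Lemma condexp_mean U W Z : is_condexp P U W Z -> 'E_P[Z] = 'E_P[U].
Proof.
move=> [_ _ ZU]; rewrite unlock; apply: ZU; exists setT => //.
by rewrite preimage_setT setIT.
Qed.

Lemma condexp_variance U W Z :
  is_condexp P U W Z -> 'E_P[U] = 0 ->
  'V_P[Z] = \int[P]_x (Z x ^+ 2)%:E.
Proof.
move=> ce EU; rewrite /variance unlock (condexp_mean ce) EU /= unlock.
apply: eq_integral => x _.
by rewrite -[LHS]/(((Z x - 0) * (Z x - 0))%R%:E) !subr0 expr2.
Qed.

(** Only the product rule on events is available; it is extended one factor at a
    time. For a fixed [A], the indicator of [U \in A] minus its probability
    integrates to 0 over every event of [sigma(V)], hence against [V]; so [V],
    being centred, integrates to 0 over every event of [sigma(U)], hence against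
    [U]. *)
Lemma independent_integral_mul U V :
  measurable_fun setT U -> measurable_fun setT V ->
  P.-integrable setT (fun x => (U x ^+ 2)%:E) ->
  P.-integrable setT (fun x => (V x ^+ 2)%:E) ->
  independent_rv P U V -> 'E_P[V] = 0 -> \int[P]_x (U x * V x)%:E = 0.
Proof.
move=> mU mV iU2 iV2 indep EV.
have iU := integrable_of_sqr mU iU2; have iV := integrable_of_sqr mV iV2.
have mUA A : measurable A -> measurable (U @^-1` A).
  by move=> mA; rewrite -[X in measurable X]setTI; exact: mU.
have mVB B : measurable B -> measurable (V @^-1` B).
  by move=> mB; rewrite -[X in measurable X]setTI; exact: mV.
under eq_integral do rewrite mulrC.
apply: integral_mul_eq0 => //; last first.
  by under eq_fun do rewrite mulrC; exact: integrable_mul_of_sqr.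
move=> A mA.
pose p := fine (P (U @^-1` A)).
have pE : p%:E = P (U @^-1` A) by rewrite fineK// fin_num_measure//; exact: mUA.
pose f x : R := (\1_(U @^-1` A) x - p)%R.
have i1 : P.-integrable setT (EFin \o (\1_(U @^-1` A) : T -> R)).
  by apply: integrable_indic => //; exact: mUA.
have ip : P.-integrable setT (EFin \o cst p).
  exact: finite_measure_integrable_cst.
have f0 B : measurable B -> \int[P]_(x in V @^-1` B) (f x)%:E = 0.
  move=> mB; have mVB' := mVB _ mB.
  under eq_integral do rewrite /f EFinB.
  rewrite integralB//; [|exact: integrableS i1|exact: integrableS ip].
  rewrite integral_indic//; last exact: mUA.
  rewrite integral_cst//.
  rewrite [X in X - _](_ : _ = p%:E * P (V @^-1` B)).
    by rewrite subee// fin_numM ?fin_num_measure//; exact: mUA.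
  by rewrite pE; exact: indep.
have if_ : P.-integrable setT (EFin \o f).
  by have := integrableB measurableT i1 ip; apply: eq_integrable.
have i1V : P.-integrable setT (fun x => (\1_(U @^-1` A) x * V x)%:E).
  apply: le_integrable iV => //.
    apply/measurable_EFinP/measurable_funM => //.
    by apply: measurable_indic; exact: mUA.
  move=> x _; rewrite /= lee_fin normrM ler_piMl// indicE.
  by case: (_ \in _); rewrite ?normr1 ?normr0.
have ipV : P.-integrable setT (fun x => (p * V x)%:E).
  by have := integrableZl measurableT p iV; apply: eq_integrable.
have := @integral_mul_eq0 _ _ _ _ f V if_ mV f0.
under eq_integral do rewrite mulrBl EFinB.
rewrite integralB//; under [X in _ - X]eq_integral do rewrite EFinM.
rewrite [X in _ - X]integralZl// -[X in _ * X]/(\int[P]_x (V x)%:E).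
have -> : \int[P]_x (V x)%:E = 0 by rewrite -EV unlock.
rewrite mule0 sube0 => <-; last first.
  have := integrableB measurableT i1V ipV; apply: eq_integrable => // x _ /=.
  by rewrite mulrBl EFinB.
rewrite integral_mkcond; apply: eq_integral => x _; rewrite patchE indicE.
by case: ifPn => _; rewrite ?mul1r ?mul0r.
Qed.

End conditional_expectation_theory.

(** * A small noise whose law charges every Lebesgue-positive set *)

Section gaussian_noise.
Context (R : realType).
Local Notation mu := (@lebesgue_measure R).

Lemma lebesgue_measure_translate (s : R) (A : set R) : measurable A ->
  mu ((fun x => s + x)%R @^-1` A) = mu A.
Proof.
move=> mA; apply/esym.
have mT : measurable_fun setT
  ((fun x => s + x)%R : measurableTypeR R -> measurableTypeR R).
  exact: measurable_funD.
rewrite (@lebesgue_measure_unique R (pushforward mu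
  ((fun x => s + x)%R : measurableTypeR R -> measurableTypeR R)))//.
move=> _ [[a b]] _ <-; rewrite /pushforward.
transitivity (mu [set` `](a - s)%R, (b - s)%R]]); last first.
  congr (mu _); apply/seteqP.
  by split=> x /=; rewrite !in_itv/= => /andP[? ?]; apply/andP; split; lra.
rewrite !lebesgue_measure_itv/= !lte_fin ltrD2r; case: ifPn => // _.
by rewrite -!EFinD; congr EFin; lra.
Qed.

Lemma integral_normal_prob (s : R) (f : R -> \bar R) :
  measurable_fun setT f -> (forall x, 0 <= f x) ->
  \int[normal_prob 0 s]_x f x = \int[mu]_x (f x * (normal_pdf 0 s x)%:E).
Proof.
move=> mf f0; have dom := normal_prob_dominates 0 s.
rewrite -(Radon_Nikodym_SigmaFinite.change_of_variables dom)//.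
have idens := Radon_Nikodym_SigmaFinite.f_integrable dom.
have mpdf : measurable_fun setT (EFin \o normal_pdf 0 s).
  by apply/measurable_EFinP; exact: measurable_normal_pdf.
apply: ae_eq_integral => //.
- by apply: emeasurable_funM => //; exact: measurable_int idens.
- exact: emeasurable_funM.
apply: ae_eqe_mul2l; apply: integral_ae_eq => // E _ mE.
by rewrite -Radon_Nikodym_SigmaFinite.f_integral.
Qed.

Lemma normal_prob_opp (s : R) (A : set R) : s != 0%R -> measurable A ->
  normal_prob 0 s (-%R @^-1` A) = normal_prob 0 s A.
Proof.
move=> s0 mA; rewrite /normal_prob.
have pdfN x : normal_pdf 0 s (- x) = normal_pdf 0 s x.
  by rewrite /normal_pdf (negbTE s0) /normal_fun !subr0 sqrrN.
have mpdf : measurable_fun setT (EFin \o normal_pdf 0 s).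
  by apply/measurable_EFinP; exact: measurable_normal_pdf.
pose opp : measurableTypeR R -> measurableTypeR R := -%R.
have mopp : measurable_fun setT opp by exact: oppr_measurable.
transitivity (\int[pushforward mu opp]_(x in A) (normal_pdf 0 s x)%:E).
  rewrite ge0_integral_pushforward//; last 2 first.
  - exact: measurable_funTS.
  - by move=> x _; rewrite lee_fin normal_pdf_ge0.
  by apply: eq_integral => x _; rewrite /= pdfN.
by apply: eq_measure_integral => B mB _; exact: lebesgue_measureN.
Qed.

(** The Gaussian density vanishes nowhere. *)
Lemma normal_prob_eq0 (s : R) (A : set R) : s != 0%R -> measurable A ->
  normal_prob 0 s A = 0 -> mu A = 0.
Proof.
move=> s0 mA; rewrite /normal_prob => A0.
have mpdf : measurable_fun A (EFin \o normal_pdf 0 s).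
  by apply/measurable_funTS/measurable_EFinP; exact: measurable_normal_pdf.
have /(ae_eq_integral_abs mu mA mpdf) :
    \int[mu]_(x in A) `|(EFin \o normal_pdf 0 s) x| = 0.
  rewrite -[RHS]A0; apply: eq_integral => x _.
  by rewrite gee0_abs// lee_fin normal_pdf_ge0.
move=> ae0; apply: measure_negligible => //.
move: ae0; rewrite /ae_eq /almost_everywhere; apply: negligibleS.
move=> x Ax /= /(_ Ax) [] /eqP; rewrite /normal_pdf (negbTE s0) mulf_eq0.
by rewrite gt_eqF ?normal_peak_gt0//= gt_eqF// expR_gt0.
Qed.

(** Half of the exponent absorbs the factor [x ^+ 2]: the function
    [x ^+ 2 * exp (- x ^+ 2 / (2 * s ^+ 2))] is bounded by
    [4 * s ^+ 2 * exp (- x ^+ 2 / (4 * s ^+ 2))] since [y * exp (- y) <= 1], and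
    the latter is proportional to the density of standard deviation
    [t = sqrt 2 * s], whose integral is 1. The ratio of the two normalizations is
    [sqrt 2], rounded up to 2. *)
Lemma normal_second_moment (s : R) : (0 < s)%R ->
  \int[normal_prob 0 s]_x (x ^+ 2)%:E <= (8 * s ^+ 2)%:E.
Proof.
move=> s0; rewrite integral_normal_prob; last 2 first.
- by apply/measurable_EFinP; exact: measurable_funX.
- by move=> x; rewrite lee_fin sqr_ge0.
pose t : R := (Num.sqrt 2 * s)%R.
have sqrt2_gt0 : (0 < Num.sqrt 2 :> R)%R by rewrite sqrtr_gt0.
have t0 : (0 < t)%R by rewrite mulr_gt0.
have t2E : (t ^+ 2 = 2 * s ^+ 2)%R by rewrite exprMn sqr_sqrtr.
have peakE : normal_peak s = (Num.sqrt 2 * normal_peak t)%R.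
  rewrite /normal_peak t2E.
  have -> : (2 * s ^+ 2 * pi *+ 2 = 2 * (s ^+ 2 * pi *+ 2) :> R)%R by ring.
  by rewrite sqrtrM// invfM mulVKf// gt_eqF.
have le2 : (Num.sqrt 2 <= 2 :> R)%R.
  by have := sqr_sqrtr (ler0n R 2); rewrite expr2; nra.
have dom x : (x ^+ 2 * normal_pdf 0 s x <= 8 * s ^+ 2 * normal_pdf 0 t x)%R.
  rewrite /normal_pdf !gt_eqF// /normal_fun !subr0 peakE t2E.
  have s2 : (0 < s ^+ 2)%R by rewrite exprn_gt0.
  pose y := (x ^+ 2 / (4 * s ^+ 2))%R.
  have xE : (x ^+ 2 = 4 * s ^+ 2 * y)%R.
    by rewrite /y mulrC divfK// gt_eqF// mulr_gt0.
  have -> : (- x ^+ 2 / (s ^+ 2 *+ 2) = - y + - y)%R.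
    by rewrite /y; field; rewrite gt_eqF.
  have -> : (- x ^+ 2 / (2 * s ^+ 2 *+ 2) = - y)%R.
    by rewrite /y; field; rewrite gt_eqF.
  rewrite expRD xE.
  have h1 : (y * expR (- y) <= 1)%R.
    rewrite expRN ler_pdivrMr ?expR_gt0// mul1r.
    by rewrite (le_trans _ (expR_ge1Dx y))// lerDr.
  have p0 : (0 <= normal_peak t)%R by exact: normal_peak_ge0.
  have e0 : (0 <= expR (- y))%R by exact: expR_ge0.
  have y0 : (0 <= y)%R by rewrite divr_ge0 ?sqr_ge0// mulr_ge0 ?(ltW s2).
  pose c := (4 * s ^+ 2 * normal_peak t * expR (- y))%R.
  rewrite [leLHS](_ : _ = c * (Num.sqrt 2 * (y * expR (- y))))%R; last first.
    by rewrite /c; ring.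
  rewrite [leRHS](_ : _ = c * (2 * 1))%R; last by rewrite /c; ring.
  rewrite ler_wpM2l//; first by rewrite !mulr_ge0// ltW.
  exact: ler_pM (ltW sqrt2_gt0) (mulr_ge0 y0 e0) le2 h1.
have mpdf u : measurable_fun setT (EFin \o normal_pdf 0 u).
  by apply/measurable_EFinP; exact: measurable_normal_pdf.
have le1 : \int[mu]_x ((x ^+ 2)%:E * (normal_pdf 0 s x)%:E) <=
    \int[mu]_x ((8 * s ^+ 2)%:E * (normal_pdf 0 t x)%:E).
  apply: ge0_le_integral => //.
  - by move=> x _; rewrite -EFinM lee_fin mulr_ge0 ?sqr_ge0 ?normal_pdf_ge0.
  - apply: emeasurable_funM; last exact: mpdf.
    by apply/measurable_EFinP; exact: measurable_funX.
  - by apply: measurable_funeM; exact: mpdf.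
  - by move=> x _; rewrite -!EFinM lee_fin.
apply: (le_trans le1).
rewrite integralZl//; last exact: integrable_normal_pdf.
by rewrite integral_normal_pdf mule1.
Qed.

(** The noise added to [Y] must be small, to stay within the constraint on the
    second moment, and yet have a law with respect to which Lebesgue measure is
    absolutely continuous, to spread every value of [X + Y] over the whole line.
    A Gaussian of small variance does both. *)
Lemma small_diffuse_noise (e : R) : (0 < e)%R ->
  exists nu : probability R R,
  [/\ nu.-integrable setT (fun x : R => (x ^+ 2)%:E),
    \int[nu]_x x%:E = 0, \int[nu]_x (x ^+ 2)%:E <= e%:E &
    forall A : set R, measurable A -> nu A = 0 -> mu A = 0].
Proof.
move=> e0; pose s := Num.sqrt (e / 8).
have s0 : (0 < s)%R by rewrite sqrtr_gt0 divr_gt0.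
have sn0 : s != 0%R by rewrite gt_eqF.
(* the Gaussian law lives on another copy of the Borel sets of [R]; it is
   carried over by the identity *)
have mid : @measurable_fun _ _ (measurableTypeR R) R setT idfun.
  exact: measurable_id.
pose idR : {mfun measurableTypeR R >-> R} :=
  @mfun_Sub _ _ (measurableTypeR R) R idfun (mem_set mid).
pose nu : probability R R := distribution (normal_prob 0 s) idR.
have le_e : \int[nu]_x (x ^+ 2)%:E <= e%:E.
  rewrite ge0_integral_distribution; last 2 first.
  - by apply/measurable_EFinP; exact: measurable_funX.
  - by move=> x; rewrite lee_fin sqr_ge0.
  rewrite (le_trans (normal_second_moment s0))// lee_fin.
  by rewrite sqr_sqrtr ?divr_ge0 ?(ltW e0)// mulrC divfK.
have i2 : nu.-integrable setT (fun x : R => (x ^+ 2)%:E).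
  apply/integrableP; split.
    by apply/measurable_EFinP; exact: measurable_funX.
  under eq_integral do rewrite gee0_abs ?lee_fin ?sqr_ge0//.
  by rewrite (le_lt_trans le_e)// ltry.
have i1 := integrable_of_sqr (@measurable_id _ R setT) i2.
exists nu; split => //; last by move=> A; exact: normal_prob_eq0.
set m := \int[_]_x _.
have mfin : m \is a fin_num by exact: integrable_fin_num.
(* the law is invariant under [-%R] *)
have oppE : m = - m.
  rewrite -integralN; last exact: integrable_add_def.
  rewrite /m (eq_measure_integral (pushforward nu (-%R : R -> R))); last first.
    by move=> A mA _; exact: (esym (normal_prob_opp sn0 mA)).
  have mopp : measurable_fun setT (-%R : R -> R) by exact: oppr_measurable.
  rewrite integral_pushforward//.
  rewrite preimage_setT; have := integrableN i1.
  by apply: eq_integrable => // x _ /=; rewrite EFinN.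
by move: oppE; rewrite -(fineK mfin) => -[] mN; congr EFin; move: mN; lra.
Qed.

End gaussian_noise.

(** * Adding an independent noise *)

Lemma integral_cst_probability (d : measure_display) (T : measurableType d)
  (R : realType) (P : probability T R) (c : \bar R) : \int[P]_x c = c.
Proof.
rewrite integral_cst// [X in _ * X](_ : _ = 1) ?mule1//.
exact: probability_setT.
Qed.

Section adding_independent_noise.
Context (d : measure_display) (T : measurableType d) (R : realType)
  (P : probability T R) (nu : probability R R).
Implicit Types (f U V S : T -> R).
Local Notation Q := (P \x nu).

Definition noisy S (z : T * R) : R := (S z.1 + z.2)%R.

Lemma measurable_noisy S :
  measurable_fun setT S -> measurable_fun setT (noisy S).
Proof.
move=> mS; apply: measurable_funD => //.
by apply: measurableT_comp => //; exact: measurable_fst.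
Qed.

Lemma ge0_integral_fst (f : T -> \bar R) : measurable_fun setT f ->
  (forall t, 0 <= f t) -> \int[Q]_z f z.1 = \int[P]_t f t.
Proof.
move=> mf f0; rewrite fubini_tonelli1//; last first.
  by apply: measurableT_comp => //; exact: measurable_fst.
by apply: eq_integral => t _; rewrite /fubini_F/= integral_cst_probability.
Qed.

Lemma integrable_fst (f : T -> \bar R) : P.-integrable setT f ->
  Q.-integrable setT (fun z => f z.1).
Proof.
move=> /integrableP[mf foo]; apply/integrableP; split.
  by apply: measurableT_comp => //; exact: measurable_fst.
by rewrite (@ge0_integral_fst (fun t => `|f t|))//; exact: measurableT_comp.
Qed.

Lemma integral_fst (f : T -> \bar R) : P.-integrable setT f ->
  \int[Q]_z f z.1 = \int[P]_t f t.
Proof.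
move=> iF; rewrite -(integral12_prod_meas1 (integrable_fst iF)).
by apply: eq_integral => t _; rewrite /fubini_F/= integral_cst_probability.
Qed.

(** Fubini, slicing at a fixed value [w] of the noise: there, adding the noise is
    a mere translation. *)
Lemma noisy_measure (E : set (T * R)) : measurable E ->
  Q E = \int[nu]_w P [set t | E (t, w)].
Proof.
move=> mE; transitivity ((P \x^ nu) E).
  apply: product_measure_unique => // A B mA mB /=.
  by rewrite product_measure2E.
apply: eq_integral => w _ /=; congr (P _).
by apply/seteqP; split=> t /=; rewrite /ysection/= inE.
Qed.

Lemma integral_noisy_preimage S f B : measurable_fun setT S ->
  P.-integrable setT (EFin \o f) -> measurable B ->
  \int[Q]_(z in noisy S @^-1` B) (f z.1)%:E =
  \int[nu]_w \int[P]_(t in (fun t => S t + w)%R @^-1` B) (f t)%:E.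
Proof.
move=> mS iF mB; rewrite integral_mkcond -integral21_prod_meas1; last first.
  apply/(integrable_mkcond (fun z => (f z.1)%:E)).
    by rewrite -[X in measurable X]setTI; exact: measurable_noisy.
  apply: (integrableS measurableT) => //.
    by rewrite -[X in measurable X]setTI; exact: measurable_noisy.
  exact: (integrable_fst iF).
by apply: eq_integral => w _; rewrite [RHS]integral_mkcond.
Qed.

(** The tower property. An event of [sigma(S + noise)], sliced at a fixed value of
    the noise, is an event of [sigma(S)], over which [U] and [Z] have the same
    integral; hence [Z] may replace [U] when conditioning on [S + noise]. *)
Lemma condexp_noisy U S Z (Z' : T * R -> R) :
  P.-integrable setT (EFin \o U) -> measurable_fun setT S ->
  is_condexp P U S Z -> is_condexp Q (U \o fst) (noisy S) Z' ->
  is_condexp Q (Z \o fst) (noisy S) Z'.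
Proof.
move=> iU mS [iZ _ ZU] [iZ' hZ' Z'U]; split => // _ [B mB <-].
rewrite Z'U; last by exists B.
rewrite setTI (integral_noisy_preimage mS iU mB).
rewrite (integral_noisy_preimage mS iZ mB).
apply: eq_integral => w _; apply/esym/ZU.
exists ((fun r => r + w)%R @^-1` B); last by rewrite setTI.
by rewrite -[X in measurable X]setTI; exact: measurable_funD.
Qed.

Lemma independent_noisy U V : measurable_fun setT U -> measurable_fun setT V ->
  independent_rv P U V -> independent_rv Q (U \o fst) (noisy V).
Proof.
move=> mU mV indep A B mA mB.
have mUA : measurable (U @^-1` A).
  by rewrite -[X in measurable X]setTI; exact: mU.
have mVB : measurable (noisy V @^-1` B).
  by rewrite -[X in measurable X]setTI; exact: measurable_noisy.
have mUA' : measurable ((U \o fst) @^-1` A : set (T * R)).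
  rewrite -[X in measurable X]setTI.
  exact: (measurableT_comp mU measurable_fst).
have mB' w : measurable ((fun r => r + w)%R @^-1` B).
  by rewrite -[X in measurable X]setTI; exact: measurable_funD.
have QA : Q ((U \o fst) @^-1` A) = P (U @^-1` A).
  rewrite -[RHS](integral_cst_probability nu); exact: noisy_measure.
have mP : measurable_fun setT (fun w => P [set t | (noisy V @^-1` B) (t, w)]).
  apply: eq_measurable_fun (measurable_fun_ysection P mVB) => w _ /=.
  by congr (P _); apply/seteqP; split=> t /=; rewrite /ysection/= inE.
transitivity (\int[nu]_w (P (U @^-1` A) *
    P [set t | (noisy V @^-1` B) (t, w)])).
  transitivity (\int[nu]_w
      P [set t | ((U \o fst) @^-1` A `&` noisy V @^-1` B) (t, w)]).
    by apply: noisy_measure; exact: measurableI.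
  by apply: eq_integral => w _; exact: (indep A _ mA (mB' w)).
rewrite ge0_integralZl//; congr (_ * _); first exact/esym.
by apply/esym; exact: noisy_measure.
Qed.

Lemma noisy_second_moment V : measurable_fun setT V ->
  P.-integrable setT (fun t => (V t ^+ 2)%:E) -> \int[P]_t (V t)%:E = 0 ->
  \int[Q]_z (noisy V z ^+ 2)%:E =
    \int[P]_t (V t ^+ 2)%:E + \int[nu]_w (w ^+ 2)%:E.
Proof.
move=> mV iV2 EV; have iV := integrable_of_sqr mV iV2.
have c1 (c : R) : P.-integrable setT (EFin \o cst c : T -> \bar R).
  exact: finite_measure_integrable_cst.
rewrite fubini_tonelli2; last 2 first.
- by apply/measurable_EFinP; apply: measurable_funX; exact: measurable_noisy.
- by move=> z; rewrite lee_fin sqr_ge0.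
transitivity (\int[nu]_w (\int[P]_t (V t ^+ 2)%:E + (w ^+ 2)%:E)).
  apply: eq_integral => w _; rewrite /fubini_G /noisy/=.
  transitivity (\int[P]_t ((V t ^+ 2)%:E +
      ((2 * w)%:E * (V t)%:E + (w ^+ 2)%:E))).
    by apply: eq_integral => t _; rewrite -EFinM -!EFinD; congr EFin; ring.
  have iZ := integrableZl measurableT (2 * w)%R iV.
  rewrite integralD//; last exact: (integrableD measurableT iZ (c1 _)).
  congr (_ + _); rewrite (integralD measurableT iZ (c1 _)) integralZl// EV.
  by rewrite mule0 add0e/= integral_cst_probability.
rewrite ge0_integralD//; last 3 first.
- by move=> w _; apply: integral_ge0 => t _; rewrite lee_fin sqr_ge0.
- by move=> w _; rewrite lee_fin sqr_ge0.
- by apply/measurable_EFinP; exact: measurable_funX.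
- by rewrite integral_cst_probability.
Qed.

Lemma noisy_mean V : measurable_fun setT V ->
  P.-integrable setT (EFin \o V) -> \int[P]_t (V t)%:E = 0 ->
  \int[nu]_w w%:E = 0 -> Q.-integrable setT (EFin \o noisy V) ->
  \int[Q]_z (noisy V z)%:E = 0.
Proof.
move=> mV iV EV Enu iQ; rewrite -integral21_prod_meas1//.
rewrite -[RHS]Enu; apply: eq_integral => w _; rewrite /fubini_G /noisy/=.
under eq_integral do rewrite EFinD.
rewrite integralD//; last exact: finite_measure_integrable_cst.
by rewrite EV add0e integral_cst_probability.
Qed.

End adding_independent_noise.

(** * Strict decrease of the variance *)

Lemma ae_eq0_of_sqr (d : measure_display) (T : measurableType d) (R : realType)
  (mu : {measure set T -> \bar R}) (f : T -> R) :
  measurable_fun setT f -> \int[mu]_x (f x ^+ 2)%:E = 0 ->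
  {ae mu, forall x, f x = 0%R}.
Proof.
move=> mf f0.
have mf2 : measurable_fun setT (fun x => (f x ^+ 2)%:E).
  by apply/measurable_EFinP; exact: measurable_funX.
have /(ae_eq_integral_abs mu measurableT mf2) : \int[mu]_x `|(f x ^+ 2)%:E| = 0.
  rewrite -[RHS]f0; apply: eq_integral => x _.
  by rewrite gee0_abs// lee_fin sqr_ge0.
by apply: filterS => x /(_ I) /= [] /eqP; rewrite sqrf_eq0 => /eqP.
Qed.

(** Testing the conditional expectation against [X + Y] gives
    [E[X ^+ 2] = E[X * (X + Y)] = E[Z * (X + Y)] = 0]. *)
Lemma condexp_sum_eq0 (d : measure_display) (T : measurableType d)
  (R : realType) (P : probability T R) (X Y Z : T -> R) :
  measurable_fun setT X -> measurable_fun setT Y ->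
  P.-integrable setT (fun x => (X x ^+ 2)%:E) ->
  P.-integrable setT (fun x => (Y x ^+ 2)%:E) ->
  independent_rv P X Y -> 'E_P[Y] = 0 ->
  is_condexp P X (X \+ Y)%R Z -> {ae P, forall x, Z x = 0%R} ->
  {ae P, forall x, X x = 0%R}.
Proof.
move=> mX mY iX2 iY2 indep EY ce Z0.
have mS : measurable_fun setT (X \+ Y)%R by exact: measurable_funD.
have iX := integrable_of_sqr mX iX2.
have iXY := integrable_mul_of_sqr mX mY iX2 iY2.
have [_ hZ _] := ce; have mZ := preimage_algebra_measurable_fun mS hZ.
apply: ae_eq0_of_sqr => //.
have ZS0 : {ae P, forall x, setT x -> (Z x * (X \+ Y)%R x)%:E = 0}.
  by apply: filterS Z0 => x -> _; rewrite mul0r.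
have mZS : measurable_fun setT (fun x => (Z x * (X \+ Y)%R x)%:E).
  by apply/measurable_EFinP; exact: measurable_funM.
have iXS : P.-integrable setT (fun x => (X x * (X \+ Y)%R x)%:E).
  have := integrableD measurableT iX2 iXY; apply: eq_integrable => // x _ /=.
  by rewrite mulrDr expr2 EFinD.
have ZSint : \int[P]_x (Z x * (X \+ Y)%R x)%:E = 0.
  by rewrite (ae_eq_integral (cst 0))// integral0.
have iZS : P.-integrable setT (fun x => (Z x * (X \+ Y)%R x)%:E).
  apply/integrableP; split => //.
  rewrite (ae_eq_integral (cst 0))//; first by rewrite integral0.
    exact: measurableT_comp.
  by apply: filterS ZS0 => x h _; rewrite h// abse0.
have : \int[P]_x (X x * (X \+ Y)%R x)%:E = 0.
  rewrite (condexp_integral_mul iX mS ce)// => B mB.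
  by exists B => //; rewrite setTI.
move=> <-; transitivity (\int[P]_x ((X x ^+ 2)%:E + (X x * Y x)%:E)).
  rewrite integralD// (independent_integral_mul mX mY iX2 iY2 indep EY).
  by rewrite adde0.
by apply: eq_integral => x _; rewrite -EFinD /= mulrDr expr2.
Qed.

(** If the noise does not change [Z], then for almost every [t] the value [Z t]
    equals [h (S t + w)] for almost every [w], hence [h u] for Lebesgue-almost
    every [u], by translation invariance. For two such points [t] and [t'] a
    common [u] exists, so that [Z t = h u = Z t']. *)
Lemma diffuse_noise_ae_constant (d : measure_display) (T : measurableType d)
  (R : realType) (P : probability T R) (nu : probability R R)
  (S Z : T -> R) (h : R -> R) :
  measurable_fun setT S -> measurable_fun setT Z -> measurable_fun setT h ->
  (forall A : set R, measurable A -> nu A = 0 -> lebesgue_measure A = 0) ->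
  {ae P \x nu, forall z, Z z.1 = h (noisy S z)} ->
  exists c : R, {ae P, forall t, Z t = c}.
Proof.
move=> mS mZ mh diffuse ZE.
pose N : set (T * R) := [set z | Z z.1 != h (noisy S z)].
have mN : measurable N.
  rewrite [N](_ : _ = (fun z => Z z.1 - h (noisy S z))%R @^-1` ~` [set 0%R]).
    rewrite -[X in measurable X]setTI; apply: measurable_funB => //.
    - exact: (measurableT_comp mZ measurable_fst).
    - exact: (measurableT_comp mh (measurable_noisy mS)).
    - exact: measurableC.
  by apply/seteqP; split=> z /=; rewrite /N/= -subr_eq0 => /eqP.
have mlev s : measurable [set u | Z s != h u].
  rewrite (_ : [set u | _] = h @^-1` ~` [set Z s]).
    by rewrite -[X in measurable X]setTI; apply: mh => //; exact: measurableC.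
  by apply/seteqP; split=> u /=; [move=> /eqP /nesym|move=> /nesym /eqP].
have N0 : (P \x nu) N = 0.
  apply: measure_negligible => //; move: ZE.
  by apply: negligibleS => z /eqP.
have G : {ae P, forall t, nu (xsection N t) = 0}.
  have mnu : measurable_fun setT (nu \o xsection N).
    exact: measurable_fun_xsection.
  have /(ae_eq_integral_abs P measurableT mnu) :
      \int[P]_t `|(nu \o xsection N) t| = 0.
    by rewrite -[RHS]N0; apply: eq_integral => t _; rewrite gee0_abs.
  by apply: filterS => t /(_ I).
have exu t t' : nu (xsection N t) = 0 -> nu (xsection N t') = 0 -> Z t = Z t'.
  have null s : nu (xsection N s) = 0 ->
      lebesgue_measure [set u | Z s != h u] = 0.
    move=> nu0; rewrite -(lebesgue_measure_translate (S s))//.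
    have := diffuse _ (measurable_xsection s mN) nu0.
    congr (lebesgue_measure _ = _).
    by apply/seteqP; split => w; rewrite /xsection/= inE.
  move=> /null t0 /null t'0; apply: contrapT => ZZ.
  have : lebesgue_measure [set` `[0%R, 1%R : R]] = 0.
    apply: (@subset_measure0 _ _ _ lebesgue_measure _
      ([set u | Z t != h u] `|` [set u | Z t' != h u])) => //.
    - exact: (measurableU _ _ (mlev t) (mlev t')).
    - move=> u _; apply: contrapT.
      move=> /not_orP[/negP/negPn/eqP e /negP/negPn/eqP e'].
      by apply: ZZ; rewrite e e'.
    - exact: etrans (@measureU0 _ (measurableTypeR R) R lebesgue_measure _ _
        (mlev t) (mlev t') t'0) t0.
  rewrite lebesgue_measure_itv/= lte01 oppr0 adde0 => -[] /eqP.
  by rewrite oner_eq0.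
have [[t0 t00]|noG] := pselect (exists t, nu (xsection N t) = 0).
  by exists (Z t0); apply: filterS G => t tG; exact: exu.
by exists 0%R; apply: filterS G => t tG; exfalso; apply: noG; exists t.
Qed.

Theorem theorem7 (R : realType) (d : measure_display) (T : measurableType d)
  (P : probability T R) (eps : R) (X : {RV P >-> R})
  (eps_ge0 : (0 <= eps)%R)
  (X_nondegenerate : nondegenerate_rv P X)
  (X_centered : 'E_P[X] = 0)
  (X_square_integrable : 'E_P[fun x => (X x ^+ 2)%R] < +oo)
  (Y : {RV P >-> R}) (Y_calV : calV P X eps Y)
  (Z : T -> R) (Z_condexp : is_condexp P X (X \+ Y)%R Z)
  (Y_minimizer : 'V_P[Z] = minvar P X eps) :
  'E_P[fun x => (Y x ^+ 2)%R] = (eps ^+ 2)%:E.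
Proof.
have [indep EY EY2le] := Y_calV.
have mX : measurable_fun setT (X : T -> R) by [].
have mY : measurable_fun setT (Y : T -> R) by [].
have mS : measurable_fun setT (X \+ Y)%R by exact: measurable_funD.
have sqr_int (V : T -> R) : measurable_fun setT V ->
    'E_P[fun x => (V x ^+ 2)%R] < +oo ->
    P.-integrable setT (fun x => (V x ^+ 2)%:E).
  move=> mV; rewrite unlock => V2; apply/integrableP; split.
    by apply/measurable_EFinP; exact: measurable_funX.
  by under eq_integral do rewrite gee0_abs ?lee_fin ?sqr_ge0//.
have iX2 := sqr_int _ mX X_square_integrable.
have iY2 := sqr_int _ mY (le_lt_trans EY2le (ltry _)).
have iX := integrable_of_sqr mX iX2; have iY := integrable_of_sqr mY iY2.
have [_ hZ _] := Z_condexp; have mZ := preimage_algebra_measurable_fun mS hZ.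
have iZ2 := condexp_sqr_integrable mX mS iX2 Z_condexp.
have EYint : \int[P]_t (Y t)%:E = 0 by rewrite -EY unlock.
apply/eqP; rewrite eq_le EY2le leNgt; apply/negP => EY2lt.
have EY2fin : 'E_P[fun x => (Y x ^+ 2)%R] \is a fin_num.
  by rewrite unlock integrable_fin_num.
pose e := (eps ^+ 2 - fine 'E_P[fun x => (Y x ^+ 2)%R])%R.
have e0 : (0 < e)%R by rewrite subr_gt0 -lte_fin fineK.
(* all the unused second moment is available for the noise *)
have [nu [inu2 Enu nu2 diffuse]] := small_diffuse_noise e0.
pose Q : probability (T * R)%type R := (P \x nu).
have mYn := measurable_noisy mY.
pose Y' : {RV Q >-> R} := mfun_Sub (mem_set mYn).
have mSn := measurable_noisy mS.
pose S' : {RV Q >-> R} := mfun_Sub (mem_set mSn).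
have iXQ : Q.-integrable setT (EFin \o (X \o fst)).
  exact: (integrable_fst nu iX).
have [h mh Z'_condexp] := condexp_exists S' iXQ.
set Z' := h \o S' in Z'_condexp.
have S'E : ((X \o fst) \+ Y')%R = S' :> (T * R -> R).
  by apply/funext => z; rewrite /= /noisy/= addrA.
have Y'2 : \int[Q]_z (Y' z ^+ 2)%:E <= (eps ^+ 2)%:E.
  rewrite [X in X <= _](noisy_second_moment nu mY iY2 EYint).
  have -> : (eps ^+ 2)%:E = \int[P]_t (Y t ^+ 2)%:E + e%:E.
    move: EY2fin; rewrite /e unlock => EY2fin.
    by rewrite -[X in _ = X + _]fineK// -EFinD addrC subrK.
  by rewrite leeD2l.
have Y'_calV : calV Q (X \o fst) eps Y'.
  split.
  - exact: independent_noisy.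
  - rewrite unlock; apply: noisy_mean => //.
    apply: integrable_of_sqr => //; apply/integrableP; split.
      by apply/measurable_EFinP; exact: measurable_funX.
    under eq_integral do rewrite gee0_abs ?lee_fin ?sqr_ge0//.
    by rewrite (le_lt_trans Y'2)// ltry.
  - by rewrite unlock.
have EXQ : 'E_Q[X \o fst] = 0.
  by rewrite unlock [LHS](integral_fst nu iX) -X_centered unlock.
have VZ' : 'V_Q[Z'] = \int[Q]_z (Z' z ^+ 2)%:E.
  exact: condexp_variance Z'_condexp EXQ.
have min_le : 'V_P[Z] <= 'V_Q[Z'].
  rewrite Y_minimizer; apply: ereal_inf_lbound; exists nu, Y', Z'.
  by split => //; rewrite S'E.
have ZfstZ' : is_condexp Q (Z \o fst) S' Z'.
  exact: condexp_noisy Z_condexp Z'_condexp.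
have mZf : measurable_fun setT (Z \o fst : T * R -> R).
  exact: (measurableT_comp mZ measurable_fst).
have iZf2 : Q.-integrable setT (fun z => ((Z \o fst) z ^+ 2)%:E).
  exact: (integrable_fst nu iZ2).
have mSn' : measurable_fun setT (S' : T * R -> R) by [].
have pyth := condexp_pythagoras mZf mSn' iZf2 ZfstZ'.
have iZ'2 := condexp_sqr_integrable mZf mSn' iZf2 ZfstZ'.
(* minimality of [Z] leaves nothing for the other term of Pythagoras *)
have dist0 : \int[Q]_z (((Z \o fst) z - Z' z) ^+ 2)%:E = 0.
  apply/eqP; rewrite eq_le integral_ge0 ?andbT; last first.
    by move=> z _; rewrite lee_fin sqr_ge0.
  move: min_le; rewrite VZ' (condexp_variance Z_condexp X_centered).
  rewrite -(integral_fst nu iZ2).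
  rewrite [X in X <= _ -> _]pyth -leeBrDr ?subee//.
    exact: integrable_fin_num.
  exact: integrable_fin_num.
have ZE : {ae Q, forall z, Z z.1 = h (noisy (X \+ Y)%R z)}.
  apply: filterS (ae_eq0_of_sqr _ dist0).
    by move=> z /eqP; rewrite subr_eq0 => /eqP.
  apply: measurable_funB => //; exact: measurableT_comp.
have [c Zc] := diffuse_noise_ae_constant mS mZ mh diffuse ZE.
have Z0 : {ae P, forall t, Z t = 0%R}.
  suff c0 : c = 0%R by rewrite c0 in Zc.
  have : \int[P]_t (Z t)%:E = 0.
    by rewrite -X_centered -(condexp_mean Z_condexp) unlock.
  rewrite (ae_eq_integral (cst c%:E))//=.
  - by rewrite integral_cst_probability => -[].
  - exact/measurable_EFinP.
  - by apply: filterS Zc => t -> _.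
apply: X_nondegenerate; exists 0%R.
exact: condexp_sum_eq0 Z_condexp Z0.
Qed.
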